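(* (Projective spread law) Let $\mathbb{F}$ be a field of characteristic not $2$ and let $B$ be an invertible symmetric $3\times 3$ matrix over $\mathbb{F}$. Let $\overline{p_1p_2p_3}$ be a tripod in $\mathbb{V}^3=\mathbb{F}^3$ whose $B$-projective quadrances $q_1,q_2,q_3$ and $B$-projective spreads $S_1,S_2,S_3$ are all defined, i.e. writing $p_i=[v_i]$, one has $Q_B(v_i)\neq 0$ for all $i$ and $Q_B(v_i\times_B v_j)\ne 0$ for all $i\neq j$. Then $$\frac{S_1}{q_1}=\frac{S_2}{q_2}=\frac{S_3}{q_3}.$$
   Context: $\mathbb{V}^3$ is the space of row vectors over $\mathbb{F}$. The $B$-scalar product is $v\cdot_B w=vBw^T$ and $Q_B(v)=v\cdot_B v$. The Euclidean vector product is $(x_1,y_1,z_1)\times(x_2,y_2,z_2)=(y_1z_2-y_2z_1,\;x_2z_1-x_1z_2,\;x_1y_2-x_2y_1)$, and the $B$-vector product is $v\times_B w=(v\times w)\,\mathrm{adj}\,B$ with $\mathrm{adj}\,B=(\det B)B^{-1}$. A projective vector $p=[v]$ is the class of a non-zero vector $v$ modulo non-zero scalars. A tripod (projective triangle) $\overline{p_1p_2p_3}$ is a set of three distinct projective vectors $p_i=[v_i]$. The $B$-projective quadrance is $q_B([v],[w])=s_B(v,w)=1-\dfrac{(v\cdot_B w)^2}{Q_B(v)Q_B(w)}$, defined when $Q_B(v),Q_B(w)\neq0$. The $B$-projective quadrances of the tripod are $q_1=q_B(p_2,p_3)$, $q_2=q_B(p_1,p_3)$, $q_3=q_B(p_1,p_2)$.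 With $r_1=[v_2\times_B v_3]$, $r_2=[v_1\times_B v_3]$, $r_3=[v_1\times_B v_2]$ (the $B$-dual), the $B$-projective spreads are $S_1=q_B(r_2,r_3)$, $S_2=q_B(r_1,r_3)$, $S_3=q_B(r_1,r_2)$. *)

(* Defs.v *)
From HB Require Import structures.
From mathcomp Require Import all_boot all_order all_algebra.
From mathcomp Require Import generic_quotient.

Set Implicit Arguments.
Unset Strict Implicit.
Unset Printing Implicit Defensive.

Import GRing.Theory.
Local Open Scope ring_scope.
Local Open Scope quotient_scope.

Section ScalarAndVectorProducts.

Variable F : fieldType.
Implicit Types (v w : 'rV[F]_3) (B : 'M[F]_3).

Definition bdot B v w : F := (v *m B *m w^T) 0 0.

Definition bquad B v : F := bdot B v v.

Definition cross v w : 'rV[F]_3 :=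
  let x1 := v 0 (inord 0) in let y1 := v 0 (inord 1) in
  let z1 := v 0 (inord 2) in
  let x2 := w 0 (inord 0) in let y2 := w 0 (inord 1) in
  let z2 := w 0 (inord 2) in
  \row_(j < 3) [:: y1 * z2 - y2 * z1;
                   x2 * z1 - x1 * z2;
                   x1 * y2 - x2 * y1]`_j.

(* [\adj B] is defined by cofactors; for invertible [B] it is
   [\det B *: invmx B]. *)
Definition bcross B v w : 'rV[F]_3 := cross v w *m \adj B.

(* Only meaningful when [bquad B v] and [bquad B w] are nonzero. *)
Definition bspread B v w : F :=
  1 - bdot B v w ^+ 2 / (bquad B v * bquad B w).

End ScalarAndVectorProducts.

Section ProjectiveVectors.

Variable F : fieldType.

Definition nzvec := {v : 'rV[F]_3 | v != 0}.

(* Equality of spans, i.e. equality up to a nonzero scalar: see [projeqP]. *)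
Definition projeq (u v : nzvec) : bool := (val u == val v)%MS.

Lemma projeqP (u v : nzvec) :
  reflect (exists2 c : F, c != 0 & val v = c *: val u) (projeq u v).
Proof.
apply: (iffP andP) => [[_ /sub_rVP[c vcu]]|[c c0 ->]].
  exists c => //; apply: contraNneq (valP v) => c0.
  by rewrite /= vcu c0 scale0r.
by rewrite scalemx_sub // -{1}[val u]scale1r -(mulVf c0) -scalerA scalemx_sub.
Qed.

Lemma projeq_equiv : equiv_class_of projeq.
Proof.
split=> [u|u v|v u w]; rewrite /projeq.
- by rewrite submx_refl.
- by rewrite andbC.
- by move=> /eqmxP uv /eqmxP vw; apply/eqmxP; apply: eqmx_trans vw.
Qed.

Canonical projeq_equivRel := EquivRelPack projeq_equiv.

Definition projvec := {eq_quot projeq}.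
HB.instance Definition _ := Choice.on projvec.
HB.instance Definition _ := EqQuotient.on projvec.

Lemma delta0_neq0 : delta_mx 0 0 != 0 :> 'rV[F]_3.
Proof.
by apply/eqP => /matrixP/(_ 0 0)/eqP; rewrite !mxE !eqxx oner_eq0.
Qed.

(* The class [v]; the zero vector, which has no class, is sent to a junk
   value. *)
Definition pvec (v : 'rV[F]_3) : projvec :=
  \pi_projvec (insubd (exist _ (delta_mx 0 0) delta0_neq0 : nzvec) v).

Lemma pvec_eqP (v w : 'rV[F]_3) : v != 0 -> w != 0 ->
  pvec v = pvec w <-> exists2 c : F, c != 0 & w = c *: v.
Proof.
move=> v0 w0; rewrite /pvec.
set a := insubd _ v; set b := insubd _ w.
have va : val a = v by rewrite val_insubd v0.
have vb : val b = w by rewrite val_insubd w0.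
rewrite -va -vb; split=> [/eqmodP/projeqP //|].
by move=> /projeqP ?; apply/eqmodP.
Qed.

(* The spread of two vectors only depends on their classes: see
   [pquadranceE]. *)
Definition pquadrance (B : 'M[F]_3) (p r : projvec) : F :=
  bspread B (val (repr p)) (val (repr r)).

Lemma bspreadZ (B : 'M[F]_3) (c d : F) (v w : 'rV[F]_3) :
  c != 0 -> d != 0 -> bspread B (c *: v) (d *: w) = bspread B v w.
Proof.
move=> c0 d0; have dotZ a b x y : bdot B (a *: x) (b *: y) = a * b * bdot B x y.
  by rewrite /bdot linearZ /= -!scalemxAl -scalemxAr !mxE mulrA.
rewrite /bspread /bquad !dotZ; congr (1 - _).
rewrite exprMn [X in _ / X]mulrACA.
have -> : c * c * (d * d) = (c * d) ^+ 2 by rewrite mulrACA -expr2.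
by rewrite -mulf_div divff ?mul1r // expf_neq0 // mulf_neq0.
Qed.

Lemma pquadranceE (B : 'M[F]_3) (v w : 'rV[F]_3) : v != 0 -> w != 0 ->
  pquadrance B (pvec v) (pvec w) = bspread B v w.
Proof.
have reprZ x : x != 0 ->
    exists2 c : F, c != 0 & val (repr (pvec x)) = c *: x.
  move=> x0; rewrite /pvec; set a := insubd _ x.
  have <- : val a = x by rewrite val_insubd x0.
  by apply/projeqP/eqmodP; rewrite reprK.
by move=> /reprZ[c c0 vE] /reprZ[d d0 wE]; rewrite /pquadrance vE wE bspreadZ.
Qed.

End ProjectiveVectors.

(* Main.v *)
Require Import Defs.
From mathcomp Require Import all_boot all_order all_algebra.
From mathcomp Require Import ring.
Import GRing.Theory.
Local Open Scope ring_scope.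

(** Everything is expressed through the Gram matrix [G] of [v1, v2, v3] for
    the form [B].  The Binet-Cauchy identity [bdot_bcross] says that, up to the
    factor [\det B], the scalar products of the vectors [bcross B vi vj] are
    the 2x2 minors of [G].  So, with [mi] the principal minor of [G] that omits
    the index [i], and [ai] the i-th diagonal entry, [q1 = m1 / (a2 * a3)],
    while [S1 = (m2 * m3 - m23 ^+ 2) / (m2 * m3)], where [m23] is an
    off-diagonal minor.  Jacobi's identity on the minors of an adjugate turns
    the last numerator into [a1 * \det G], whence
    [S1 / q1 = a1 * a2 * a3 * \det G / (m1 * m2 * m3)] ([spread_ratioE]).
    This is symmetric in the three indices, which is the spread law. *)

Set Implicit Arguments.
Unset Strict Implicit.
Unset Printing Implicit Defensive.

Section SpreadLaw.

Variable F : fieldType.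
Implicit Types (u v w x : 'rV[F]_3) (B M : 'M[F]_3).

Lemma big_ord3 (f : 'I_3 -> F) :
  \sum_i f i = f (inord 0) + f (inord 1) + f (inord 2).
Proof.
rewrite !big_ord_recr big_ord0 /= add0r.
by congr (f _ + f _ + f _); apply/val_inj; rewrite /= inordK.
Qed.

Lemma cross_dot u v w x :
  (cross u v *m (cross w x)^T) 0 0 =
  (u *m w^T) 0 0 * (v *m x^T) 0 0 - (u *m x^T) 0 0 * (v *m w^T) 0 0.
Proof. by rewrite !mxE !big_ord3 !mxE !inordK //=; ring. Qed.

Lemma det_mx22 (N : 'M[F]_2) : \det N = N 0 0 * N 1 1 - N 0 1 * N 1 0.
Proof.
have l01 : lift 0 0 = 1 :> 'I_2 by apply/val_inj.
have l10 : lift 1 0 = 0 :> 'I_2 by apply/val_inj.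
rewrite (expand_det_row N 0) big_ord_recl big_ord1 /cofactor.
by rewrite !det_mx11 !mxE l01 l10 /=; ring.
Qed.

Lemma cofactor3E M (i j i1 i2 j1 j2 : 'I_3) :
  i1 = lift i 0 -> i2 = lift i 1 -> j1 = lift j 0 -> j2 = lift j 1 ->
  cofactor M i j = (-1) ^+ (i + j) * (M i1 j1 * M i2 j2 - M i1 j2 * M i2 j1).
Proof. by move=> -> -> -> ->; rewrite /cofactor det_mx22 !mxE. Qed.

(** Each coordinate of the left-hand side is, up to sign, a 2x2 minor of the
    product of the matrix with rows [u, v] and [M]; expanding it by
    Cauchy-Binet, the minors of [M] that occur are, up to sign, its
    cofactors. *)
Lemma cross_mulmx M u v :
  cross (u *m M) (v *m M) = cross u v *m (\adj M)^T.
Proof.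
(* The index pairs left after deleting one row or column. *)
have l0 : [/\ inord 1 = lift (inord 0 : 'I_3) 0
          & inord 2 = lift (inord 0 : 'I_3) 1].
  by split; apply/val_inj; rewrite /= /bump !inordK.
have l1 : [/\ inord 0 = lift (inord 1 : 'I_3) 0
          & inord 2 = lift (inord 1 : 'I_3) 1].
  by split; apply/val_inj; rewrite /= /bump !inordK.
have l2 : [/\ inord 0 = lift (inord 2 : 'I_3) 0
          & inord 1 = lift (inord 2 : 'I_3) 1].
  by split; apply/val_inj; rewrite /= /bump !inordK.
case: l0 l1 l2 => l00 l01 [l10 l11] [l20 l21].
apply/rowP => j; rewrite [RHS]mxE big_ord3 !mxE !big_ord3 !inordK //=.
have [->|[->|->]] :
    j = inord 0 \/ j = inord 1 \/ j = inord 2.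
  by case: j => [[|[|[|//]]] ?]; [left|right; left|right; right];
    apply/val_inj; rewrite /= inordK.
- rewrite (cofactor3E M l00 l01 l00 l01).
  rewrite (cofactor3E M l10 l11 l00 l01).
  rewrite (cofactor3E M l20 l21 l00 l01).
  by rewrite !inordK //=; ring.
- rewrite (cofactor3E M l00 l01 l10 l11).
  rewrite (cofactor3E M l10 l11 l10 l11).
  rewrite (cofactor3E M l20 l21 l10 l11).
  by rewrite !inordK //=; ring.
- rewrite (cofactor3E M l00 l01 l20 l21).
  rewrite (cofactor3E M l10 l11 l20 l21).
  rewrite (cofactor3E M l20 l21 l20 l21).
  by rewrite !inordK //=; ring.
Qed.

(** Since [\adj B *m B] is the scalar matrix [\det B], the product reduces to
    [\det B] times [cross u v *m (\adj B)^T *m (cross w x)^T]; by [cross_mulmx]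
    the adjugate moves into the first vector product, and the Euclidean
    identity [cross_dot] applies. *)
Lemma bdot_bcross B u v w x :
  bdot B (bcross B u v) (bcross B w x) =
  \det B * (bdot B u w * bdot B v x - bdot B u x * bdot B v w).
Proof.
rewrite /bdot /bcross trmx_mul -(mulmxA (cross u v)) mul_adj_mx.
rewrite mul_mx_scalar -scalemxAl mulmxA -cross_mulmx mxE.
by rewrite cross_dot.
Qed.

Lemma bdotC B u v : B^T = B -> bdot B u v = bdot B v u.
Proof.
move=> symB; rewrite /bdot -{1}(trmxK u) -mulmxA -{1}(trmxK (B *m _)).
by rewrite -trmx_mul mxE trmx_mul trmxK symB.
Qed.

Lemma bquad_neq0 B v : bquad B v != 0 -> v != 0.
Proof. by apply: contraNneq => ->; rewrite /bquad /bdot !mul0mx mxE. Qed.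

Lemma bcrossC B u v : bcross B u v = -1 *: bcross B v u.
Proof.
rewrite /bcross scalemxAl; congr (_ *m _).
by apply/rowP => -[[|[|[|//]]] ?]; rewrite !mxE /=; ring.
Qed.

Lemma bspreadC B v w : B^T = B -> bspread B v w = bspread B w v.
Proof.
by move=> symB; rewrite /bspread (bdotC _ _ symB) [bquad B v * _]mulrC.
Qed.

(** The determinant of the Gram matrix of [u, v, w] when [B] is symmetric. *)
Definition gram3 B u v w : F :=
  bquad B u * bquad B v * bquad B w
  + 2%:R * (bdot B v w * bdot B u w * bdot B u v)
  - bquad B u * bdot B v w ^+ 2 - bquad B v * bdot B u w ^+ 2
  - bquad B w * bdot B u v ^+ 2.

Definition gram2 B v w : F := bquad B v * bquad B w - bdot B v w ^+ 2.

Lemma bquad_bcross B v w : B^T = B ->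
  bquad B (bcross B v w) = \det B * gram2 B v w.
Proof.
by move=> symB; rewrite /bquad bdot_bcross (bdotC w v symB) -expr2.
Qed.

(** After [bdot_bcross], the numerator of the spread is
    [gram2 B u v * gram2 B u w] minus the square of
    [bquad B u * bdot B v w - bdot B u w * bdot B u v], which is
    [bquad B u * gram3 B u v w] by Jacobi's identity.  As
    [bspread B v w = gram2 B v w / (bquad B v * bquad B w)], the condition
    [bquad B (bcross B v w) != 0] makes the divisor nonzero. *)
Lemma spread_ratioE B u v w : B^T = B ->
  bquad B u != 0 -> bquad B v != 0 -> bquad B w != 0 ->
  bquad B (bcross B u v) != 0 -> bquad B (bcross B u w) != 0 ->
  bquad B (bcross B v w) != 0 ->
  bspread B (bcross B u v) (bcross B u w) / bspread B v w =
  bquad B u * bquad B v * bquad B w * gram3 B u v w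
  / (gram2 B u v * gram2 B u w * gram2 B v w).
Proof.
move=> symB Qu Qv Qw; rewrite /bspread !bquad_bcross //.
rewrite !mulf_eq0 !negb_or => /andP[d0 Guv] /andP[_ Guw] /andP[_ Gvw].
rewrite bdot_bcross -/(bquad B u) (bdotC v u symB).
move: Guv Guw Gvw Qu Qv Qw d0; rewrite /gram3 /gram2.
move: (bquad B u) (bquad B v) (bquad B w) (\det B).
move: (bdot B u v) (bdot B u w) (bdot B v w) => uv uw vw a b c d *.
by field; do ?[apply/andP; split].
Qed.

End SpreadLaw.

Theorem theorem25 (F : fieldType) (charF : 2%N \notin [pchar F])
  (B : 'M[F]_3) (symB : B^T = B) (invB : B \in unitmx)
  (v1 v2 v3 : 'rV[F]_3) (v1_neq0 : v1 != 0) (v2_neq0 : v2 != 0)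
  (v3_neq0 : v3 != 0)
  (distinct : uniq [:: pvec v1; pvec v2; pvec v3])
  (Qv1 : bquad B v1 != 0) (Qv2 : bquad B v2 != 0) (Qv3 : bquad B v3 != 0)
  (Qv23 : bquad B (bcross B v2 v3) != 0)
  (Qv13 : bquad B (bcross B v1 v3) != 0)
  (Qv12 : bquad B (bcross B v1 v2) != 0) :
  let p1 := pvec v1 in let p2 := pvec v2 in let p3 := pvec v3 in
  let r1 := pvec (bcross B v2 v3) in
  let r2 := pvec (bcross B v1 v3) in
  let r3 := pvec (bcross B v1 v2) in
  let q1 := pquadrance B p2 p3 in
  let q2 := pquadrance B p1 p3 in
  let q3 := pquadrance B p1 p2 in
  let S1 := pquadrance B r2 r3 in
  let S2 := pquadrance B r1 r3 in
  let S3 := pquadrance B r1 r2 in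
  S1 / q1 = S2 / q2 /\ S2 / q2 = S3 / q3.
Proof.
have opp1_neq0 : -1 != 0 :> F by rewrite oppr_eq0 oner_eq0.
have QC v w : bquad B (bcross B v w) = bquad B (bcross B w v).
  by rewrite !bquad_bcross // /gram2 (bdotC v w symB) [bquad B v * _]mulrC.
move=> /=; rewrite !pquadranceE
  ?(bquad_neq0 Qv23, bquad_neq0 Qv13, bquad_neq0 Qv12) //.
have -> : bspread B (bcross B v1 v3) (bcross B v1 v2)
        = bspread B (bcross B v1 v2) (bcross B v1 v3) by rewrite bspreadC.
(* The other two spreads are at the vertices [v2] and [v3]: the products are
   reversed so that the common vertex comes first. *)
have -> : bspread B (bcross B v2 v3) (bcross B v1 v2)
        = bspread B (bcross B v2 v1) (bcross B v2 v3).
  by rewrite bspreadC // -(bspreadZ B (bcross B v2 v1) _ opp1_neq0 (oner_neq0 F))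
             -bcrossC scale1r.
have -> : bspread B (bcross B v2 v3) (bcross B v1 v3)
        = bspread B (bcross B v3 v1) (bcross B v3 v2).
  by rewrite bspreadC // (bcrossC B v1) (bcrossC B v2) bspreadZ.
rewrite !spread_ratioE // 1?QC //.
rewrite /gram3 /gram2 (bdotC v2 v1 symB) (bdotC v3 v1 symB) (bdotC v3 v2 symB).
by split; congr (_ / _); ring.
Qed.
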